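(* Let $N\ge1$, $d\ge2$, let $\bm{p}=(p_1,\ldots,p_d)$ be a probability distribution with all $p_j>0$, and let $\bm{u}=\{u^{(l)}\}_{l=0}^{d-1}$ be real functions on $\{1,\ldots,d\}$ with $u^{(0)}\equiv1$ that are orthonormal on $\bm{p}$: $\sum_{i=1}^d u^{(l)}_iu^{(m)}_ip_i=\delta_{lm}$. Let $P=(p_{jl})$ be a $d\times d$ transition matrix with stationary distribution $\bm{p}$ such that $$p_{jl}=p_l\Big\{1+\sum_{i=1}^{d-1}\rho_iu_j^{(i)}u_l^{(i)}\Big\},\qquad j,l=1,\ldots,d,$$ for real numbers $\rho_1,\ldots,\rho_{d-1}$. Let $\{\bm{X}(t)\}_{t\ge0}$ be the continuous-time random walk on $\{\bm{x}\in\mathbb{Z}_{\ge0}^d:|\bm{x}|=N\}$ in which transitions $\bm{x}\to\bm{x}-\bm{e}_j+\bm{e}_l$ are made at rate $(x_j/N)p_{jl}$. Then the transition functions $p(\bm{x},\bm{y};t)=P(\bm{X}(t)=\bm{y}\mid\bm{X}(0)=\bm{x})$ have the eigenfunction expansion $$p(\bm{x},\bm{y};t)=m(\bm{y};\bm{p})\Bigg\{1+\sum_{\{\bm{n}:0<|\bm{n}|\le N\}}e^{-t\sum_{i=1}^{d-1}n_i(1-\rho_i)/N}\binom{N}{\bm{n}^+}^{-1}Q_{\bm{n}}(\bm{x};\bm{u})Q_{\bm{n}}(\bm{y};\bm{u})\Bigg\},$$ the sum being over $\bm{n}=(n_1,\ldots,n_{d-1})\in\mathbb{Z}_{\ge0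}^{d-1}$.
   Context: $|\cdot|$ denotes the sum of entries of a vector and $\bm{e}_j$ the $j$th standard unit vector. $m(\bm{y};\bm{p})=\frac{N!}{\prod_jy_j!}\prod_{j=1}^dp_j^{y_j}$ is the multinomial distribution. $\bm{n}^+=(n_0,n_1,\ldots,n_{d-1})$ with $n_0=N-|\bm{n}|$, and $\binom{N}{\bm{n}^+}=N!/\prod_{j=0}^{d-1}n_j!$. The multivariate Krawtchouk polynomial $Q_{\bm{n}}(\bm{x};\bm{u})$ is the coefficient of $w_1^{n_1}\cdots w_{d-1}^{n_{d-1}}$ in $$\prod_{j=1}^d\Big(1+\sum_{l=1}^{d-1}w_lu_j^{(l)}\Big)^{x_j}.$$ *)

(* Defs.v *)
From HB Require Import structures.
From mathcomp Require Import all_boot all_order all_algebra.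
From mathcomp Require Import all_classical all_reals all_analysis.
(* The notations of [mpoly] clash with those of mathcomp-analysis. *)
From mathcomp Require mpoly.
Import (coercions, canonicals) mpoly.

Set Implicit Arguments.
Unset Strict Implicit.
Unset Printing Implicit Defensive.

Import Order.TTheory GRing.Theory Num.Theory.
Import numFieldNormedType.Exports.
Local Open Scope classical_set_scope.
Local Open Scope ring_scope.

Section ContinuousTimeChain.
Context {R : realType} {disp : measure_display} {T : measurableType disp}.

(* The value is 0 when [B] is a null event. *)
Definition cond_prob (Pr : probability T R) (A B : set T) : R :=
  fine (Pr (A `&` B)) / fine (Pr B).

(* [X t] is only constrained for [0 <= t].  Only the off-diagonal values of
   [q] matter; as the state space is finite, [jp_rate] also determines the
   probability of staying at [x] to first order.  In [jp_markov] the observation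
   times [tau] of the history may come in any order and be repeated. *)
Record is_jump_process (S : finType) (Pr : probability T R)
    (X : R -> T -> S) (q : S -> S -> R) : Prop := IsJumpProcess {
  jp_measurable : forall (t : R) (x : S), 0 <= t ->
    measurable [set w | X t w = x];
  jp_markov : forall (k : nat) (tau : 'I_k -> R) (z : 'I_k -> S)
      (s h : R) (x y : S),
    0 <= s -> 0 <= h -> (forall i, 0 <= tau i <= s) ->
    let hist := [set w | forall i, X (tau i) w = z i] in
    Pr ([set w | X s w = x] `&` hist) != 0%E ->
    cond_prob Pr [set w | X (s + h) w = y] ([set w | X s w = x] `&` hist)
    = cond_prob Pr [set w | X (s + h) w = y] [set w | X s w = x];
  jp_homogeneous : forall (s s' h : R) (x y : S),
    0 <= s -> 0 <= s' -> 0 <= h ->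
    Pr [set w | X s w = x] != 0%E -> Pr [set w | X s' w = x] != 0%E ->
    cond_prob Pr [set w | X (s + h) w = y] [set w | X s w = x]
    = cond_prob Pr [set w | X (s' + h) w = y] [set w | X s' w = x];
  jp_rate : forall (s : R) (x y : S),
    0 <= s -> x != y -> Pr [set w | X s w = x] != 0%E ->
    (cond_prob Pr [set w | X (s + h) w = y] [set w | X s w = x] / h)
      @[h --> 0^'+] --> q x y
}.

End ContinuousTimeChain.

(* Vectors of [d] nonnegative integers are monomial exponents
   [mpoly.multinom d]; the bound on the degree only serves to make the type of
   vectors with entries summing to [N] a [finType]. *)
Definition config (d N : nat) : Type :=
  {x : mpoly.bmultinom d N.+1 | mpoly.mdeg x == N}.

HB.instance Definition _ (d N : nat) := Finite.on (config d N).

Definition config_vec d N (x : config d N) : mpoly.multinom d :=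
  mpoly.bmnm (val x).

Coercion config_vec : config >-> mpoly.multinom.

Section Walk.
Context {R : realType}.

(* The condition is [y = x - e_j + e_l]; if [x j = 0] the summand is 0.  For
   [x != y] at most one pair [(j, l)] contributes. *)
Definition walk_rate d N (P : 'I_d -> 'I_d -> R) (x y : config d N) : R :=
  \sum_(j < d) \sum_(l < d |
      mpoly.mnm_add y (mpoly.mnm1 j) == mpoly.mnm_add x (mpoly.mnm1 l))
    (x j)%:R / N%:R * P j l.

Definition multinomial_pmf d N (p : 'I_d -> R) (y : config d N) : R :=
  N`!%:R / (\prod_(j < d) (y j)`!%:R) * \prod_(j < d) p j ^+ y j.

(* For [mdeg n <= N]; the part [n_0] is [N - mdeg n]. *)
Definition multinomial_coef r N (n : mpoly.multinom r) : R :=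
  N`!%:R / ((N - mpoly.mdeg n)`!%:R * \prod_(i < r) (n i)`!%:R).

(* The [r + 1] functions [u^(0), ..., u^(r)] on [r + 1] points are the rows of
   [u]; the variable [w_(i+1)] is ['X_i], going with [u^(i+1) = u (lift ord0 i)]. *)
Definition krawtchouk r (u : 'I_r.+1 -> 'I_r.+1 -> R)
    (n : mpoly.multinom r) (x : mpoly.multinom r.+1) : R :=
  mpoly.mcoeff n
    (\prod_(j < r.+1)
      (1 + \sum_(i < r) u (lift ord0 i) j *: mpoly.mpolyX R (mpoly.mnm1 i))
        ^+ x j).

End Walk.

(* Main.v *)
Require Import Defs.
From mathcomp Require Import all_boot all_order all_algebra.
From mathcomp Require Import all_classical all_reals all_analysis.
From mathcomp Require Import ring lra.
From mathcomp Require mpoly.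
Import (coercions, canonicals) mpoly.
Import -(notations) mpoly.
Import Order.TTheory GRing.Theory Num.Theory.
Import numFieldNormedType.Exports.

Set Implicit Arguments.
Unset Strict Implicit.
Unset Printing Implicit Defensive.

Local Open Scope classical_set_scope.
Local Open Scope ring_scope.

(* Homogenizing with a variable [w_0], [Q_n(x)] is the coefficient of [w^(n^+)]
   in [F_x = \prod_j (\sum_l u_j^(l) w_l)^(x_j)], where [n^+] has
   [n_0 = N - |n|].  As [\sum_l P j l u_l^(i) = rho_i u_j^(i)] (with
   [rho_0 = 1]), the generator of the walk acts on [x |-> F_x] as
   [N^-1 \sum_i (rho_i - 1) w_i d/dw_i], so each [Q_n] is an eigenfunction with
   eigenvalue [- \sum_i n_i (1 - rho_i) / N].  Substituting
   [w_l = \sum_k p_k u_k^(l) z_k] turns [F_x] into [z^x]; comparing the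
   coefficients of [z^y], and using that [Q_n(y) \prod_l n_l! / \prod_j y_j!]
   is the same coefficient with [n^+] and [y] exchanged and [u] transposed, the
   indicator of [x = y] is [m(y; p) \sum_n binom(N, n^+)^-1 Q_n(x) Q_n(y)].
   For an eigenfunction [phi] with eigenvalue [- c], the rates give
   [E[phi(X(s+h))] = exp(- c h) E[phi(X(s))] + o(h)] uniformly in [s], hence
   [E[phi(X(t))] = exp(- c t) phi(x)] by subdividing [[0, t]]. *)

(** * Products of linear forms and their coefficients *)

Section LinearForms.
Context {R : comNzRingType} {d : nat}.
Implicit Types (a b : 'I_d -> 'I_d -> R) (x y m : multinom d) (i j l : 'I_d).

(** The index [j] is the point and [l] the variable, so the functions of the theorem enter as the
    transpose [a j l = u l j]. *)
Definition linform a j : mpoly d R := \sum_(l < d) a j l *: mpolyX R (mnm1 l).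

Definition prodform a x : mpoly d R := \prod_(j < d) linform a j ^+ x j.

Lemma submU1K m i : (0 < m i)%N -> mnm_add (mnm_sub m (mnm1 i)) (mnm1 i) = m.
Proof.
move=> mi; apply/mnmP => j; rewrite mnmDE mnmBE mnm1E.
by case: eqVneq => [<-|_]; rewrite ?subnK ?subn0 ?addn0.
Qed.

Lemma multinom_ind (Q : multinom d -> Prop) :
  Q mnm0 -> (forall m i, Q m -> Q (mnm_add m (mnm1 i))) -> forall m, Q m.
Proof.
move=> Q0 QS m; have [k] := ubnP (mdeg m); elim: k m => // k IH m mk.
have [->//|m0] := eqVneq m mnm0.
have [i mi] : exists i, (0 < m i)%N.
  apply/existsP; apply: contraR m0 => /existsPn m0; apply/eqP/mnmP => i.
  by rewrite mnm0E; apply/eqP; rewrite -leqn0 leqNgt m0.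
have e := submU1K mi; rewrite -e; apply/QS/IH; move: mk.
by rewrite -{1}e mdegD mdeg1 addn1.
Qed.

Lemma mcoeffMXU (f : mpoly d R) i m :
  mcoeff m (f * mpolyX R (mnm1 i)) =
  if (0 < m i)%N then mcoeff (mnm_sub m (mnm1 i)) f else 0.
Proof.
case: ifPn => mi.
  by rewrite -[in LHS](submU1K mi) addmC mcoeffMX.
rewrite mulrC mcoeffM big1// => -[/= k1 k2] /eqP mE; rewrite mcoeffX.
case: eqVneq => [k1E|_]; last by rewrite mul0r.
have mi1 : (0 < m i)%N by rewrite {1}mE mnmDE -k1E mnm1E eqxx.
by rewrite mi1 in mi.
Qed.

(** The operator [w_i d/dw_i] is diagonal on monomials; this is how eigenvalues are read off
    coefficients. *)
Lemma mcoeffX_mderiv (f : mpoly d R) i m :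
  mcoeff m (mderiv i f * mpolyX R (mnm1 i)) = (m i)%:R * mcoeff m f.
Proof.
rewrite mcoeffMXU; case: ifPn => [mi|]; last first.
  by rewrite -eqn0Ngt => /eqP ->; rewrite mul0r.
by rewrite mcoeff_deriv mnmBE mnm1E eqxx subn1 prednK// mulr_natl submU1K.
Qed.

Lemma prodform0 a : prodform a mnm0 = 1.
Proof. by rewrite /prodform big1// => j _; rewrite mnm0E expr0. Qed.

Lemma prodformD1 a x j :
  prodform a (mnm_add x (mnm1 j)) = prodform a x * linform a j.
Proof.
rewrite /prodform; under eq_bigr do rewrite mnmDE exprD.
rewrite big_split /=; congr (_ * _); rewrite (bigD1 j)//= mnm1E eqxx expr1.
by rewrite big1 ?mulr1// => i ij; rewrite mnm1E eq_sym (negPf ij) expr0.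
Qed.

Lemma prodform_homog a x m : mdeg m != mdeg x -> mcoeff m (prodform a x) = 0.
Proof.
elim/multinom_ind: x m => [|x j IH] m mx.
  by rewrite prodform0 mcoeff1; case: (eqVneq m) mx => // -> /eqP.
rewrite prodformD1 /linform mulr_sumr raddf_sum big1//= => l _.
rewrite -scalerAr mcoeffZ mcoeffMXU; case: ifPn => [ml|]; rewrite ?mulr0//.
rewrite IH ?mulr0//; apply: contra mx => /eqP mx.
by rewrite -(submU1K ml) !mdegD !mdeg1 mx.
Qed.

Lemma mderiv_linform a i j : mderiv i (linform a j) = mpolyC d (a j i).
Proof.
rewrite /linform raddf_sum/= (bigD1 i)//= big1 ?addr0 => [|l li].
  rewrite mderivZ mderivX mnm1E eqxx scale1r.
  have -> : mnm_sub (mnm1 i) (mnm1 i) = mnm0 :> multinom d.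
    by apply/mnmP => k; rewrite mnmBE mnm0E subnn.
  by rewrite mpolyX0 -alg_mpolyC.
by rewrite mderivZ mderivX mnm1E (negPf li) scale0r scaler0.
Qed.

(** Leibniz rule. When [x j = 0] the truncated [mnm_sub] is harmless, since the factor [x j] kills
    the term. *)
Lemma mderiv_prodform a x i :
  mderiv i (prodform a x) =
  \sum_(j < d) ((x j)%:R * a j i) *: prodform a (mnm_sub x (mnm1 j)).
Proof.
elim/multinom_ind: x => [|x k IH].
  rewrite prodform0 -mpolyC1 mderivC big1// => j _.
  by rewrite mnm0E mul0r scale0r.
rewrite prodformD1 mderivM IH mderiv_linform mulr_suml.
under [RHS]eq_bigr do rewrite mnmDE natrD mulrDl scalerDl.
rewrite big_split /=; congr (_ + _).
  apply: eq_bigr => j _; rewrite -scalerAl -prodformD1.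
  have [xj|xj] := posnP (x j); first by rewrite xj mul0r !scale0r.
  congr (_ *: prodform _ _); apply/mnmP => l; rewrite !(mnmDE, mnmBE) addnBAC//.
  by rewrite mnm1E; case: eqVneq => // <-.
rewrite (bigD1 k)//= mnm1E eqxx mul1r big1 ?addr0 => [|j jk]; last first.
  by rewrite mnm1E eq_sym (negPf jk) mul0r scale0r.
rewrite mulrC mul_mpolyC; congr (_ *: prodform _ _).
by apply/mnmP => l; rewrite mnmBE mnmDE addnK.
Qed.

Lemma mcoeff0_linform a j : mcoeff mnm0 (linform a j) = 0.
Proof.
by rewrite /linform raddf_sum big1//= => l _; rewrite mcoeffZ mcoeffX mnm1_eq0 mulr0.
Qed.

Definition mfact m := (\prod_(i < d) (m i)`!)%N.

Lemma mfactD1 m i : mfact (mnm_add m (mnm1 i)) = ((m i).+1 * mfact m)%N.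
Proof.
rewrite /mfact (bigD1 i)//= [in RHS](bigD1 i)//= mnmDE mnm1E eqxx addn1 factS.
rewrite -mulnA; congr (_ * (_ * _))%N; apply: eq_bigr => j ji.
by rewrite mnmDE mnm1E eq_sym (negPf ji) addn0.
Qed.

(* Both sides are [mfact x * mfact m] times the sum of
   [\prod_(j, l) a j l ^+ k j l / (k j l)`!] over the nonnegative integer
   matrices [k] with row sums [x] and column sums [m]. *)
Lemma prodform_duality a x m :
  mcoeff m (prodform a x) * (mfact m)%:R =
  mcoeff x (prodform (fun i j => a j i) m) * (mfact x)%:R.
Proof.
elim/multinom_ind: m x => [|m i IH] x.
  rewrite prodform0 mcoeff1; elim/multinom_ind: x => [|x j _].
    by rewrite prodform0 mcoeff1 eqxx.
  rewrite mnmD_eq0 mnm1_eq0 andbF mul0r prodformD1.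
  by rewrite [mcoeff _ _]rmorphM/= mcoeff0_linform mulr0 mul0r.
(* The factor [(m i).+1] makes the left side a coefficient of a derivative, a sum over [j]; on the
   right the additional linear form is expanded over [j]. The two sums agree termwise by
   induction. *)
rewrite mfactD1 natrM mulrA [X in X * _]mulr_natr -mcoeff_deriv mderiv_prodform.
rewrite prodformD1 /linform mulr_sumr !raddf_sum !mulr_suml.
apply: eq_bigr => j _ /=; rewrite -scalerAr !mcoeffZ mcoeffMXU.
have [xj|xj] := posnP (x j); first by rewrite xj mulr0 !mul0r.
have -> : mfact x = (x j * mfact (mnm_sub x (mnm1 j)))%N.
  by rewrite -{1}(submU1K xj) mfactD1 mnmBE mnm1E eqxx subn1 prednK.
by rewrite -mulrA IH natrM; ring.
Qed.

(** Averaging the replaced linear form over [P j] multiplies its coefficient of [w_i] by [lam i].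
    Summed over [j], this is [\sum_i lam i * w_i d/dw_i] applied to the product. *)
Lemma prodform_generator a (P : 'I_d -> 'I_d -> R) (lam : 'I_d -> R) x m :
  (forall j i, \sum_(l < d) P j l * a l i = lam i * a j i) ->
  \sum_(j < d) \sum_(l < d) (x j)%:R * P j l *
    mcoeff m (prodform a (mnm_add (mnm_sub x (mnm1 j)) (mnm1 l)))
  = (\sum_(i < d) lam i * (m i)%:R) * mcoeff m (prodform a x).
Proof.
move=> Pa; rewrite mulr_suml.
under [RHS]eq_bigr do rewrite -mulrA -mcoeffX_mderiv -mcoeffZ.
rewrite -raddf_sum/=.
have PT j : \sum_l P j l *: linform a l = \sum_i (lam i * a j i) *: mpolyX R (mnm1 i).
  under eq_bigr do rewrite scaler_sumr.
  rewrite exchange_big/=; apply: eq_bigr => i _.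
  by rewrite -Pa scaler_suml; apply: eq_bigr => l _; rewrite scalerA.
transitivity (mcoeff m (\sum_j (x j)%:R *: (prodform a (mnm_sub x (mnm1 j)) *
    \sum_l P j l *: linform a l))).
  rewrite raddf_sum; apply: eq_bigr => j _ /=.
  rewrite mcoeffZ mulr_sumr raddf_sum mulr_sumr; apply: eq_bigr => l _ /=.
  by rewrite -scalerAr mcoeffZ -prodformD1 mulrA.
congr (mcoeff m _).
under [LHS]eq_bigr do rewrite PT mulr_sumr scaler_sumr.
rewrite exchange_big; apply: eq_bigr => i _.
rewrite mderiv_prodform mulr_suml scaler_sumr; apply: eq_bigr => j _.
rewrite -scalerAr -scalerAl !scalerA; congr (_ *: _).
by rewrite mulrCA.
Qed.

End LinearForms.

(** * Homogenization and the Krawtchouk coefficients *)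

Section Homogenization.
Context {R : comNzRingType} {r : nat}.
Implicit Types (n : multinom r) (m : multinom r.+1) (N : nat).

(* The exponent [n^+] of the paper, with [n_0 = N - |n|] in front. *)
Definition homog_exp N n : multinom r.+1 :=
  Multinom [tuple (if unlift ord0 i is Some k then n k else N - mdeg n)%N
           | i < r.+1].

Definition dehomog_exp m : multinom r :=
  Multinom [tuple m (lift ord0 i) | i < r].

Lemma homog_exp0 N n : homog_exp N n ord0 = (N - mdeg n)%N.
Proof. by rewrite mnmE unlift_none. Qed.

Lemma homog_expS N n i : homog_exp N n (lift ord0 i) = n i.
Proof. by rewrite mnmE liftK. Qed.

Lemma homog_expK N : cancel (homog_exp N) dehomog_exp.
Proof. by move=> n; apply/mnmP => i; rewrite mnmE homog_expS. Qed.

Lemma mdeg_homog_exp N n : (mdeg n <= N)%N -> mdeg (homog_exp N n) = N.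
Proof.
move=> nN; rewrite mdegE big_ord_recl homog_exp0.
by under eq_bigr do rewrite homog_expS; rewrite -mdegE subnK.
Qed.

Lemma mdeg_dehomog_exp m : (m ord0 + mdeg (dehomog_exp m))%N = mdeg m.
Proof.
rewrite [RHS]mdegE big_ord_recl mdegE; congr (_ + _)%N.
by apply: eq_bigr => i _; rewrite mnmE.
Qed.

Lemma dehomog_expK m : homog_exp (mdeg m) (dehomog_exp m) = m.
Proof.
apply/mnmP => i; case: (unliftP ord0 i) => [j|] ->.
  by rewrite homog_expS mnmE.
by rewrite homog_exp0 -mdeg_dehomog_exp addnK.
Qed.

(** Exponents of degree [N] in [r.+1] variables correspond to exponents of degree at most [N] in [r]
    variables, which form a finite type to sum over. *)
Lemma homogeneous_expansion N (f : mpoly r.+1 R) :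
  (forall m, mdeg m != N -> mcoeff m f = 0) ->
  f = \sum_(n : bmultinom r N.+1)
        mcoeff (homog_exp N n) f *: mpolyX R (homog_exp N n).
Proof.
move=> fN; apply/mpolyP => m; rewrite raddf_sum/=.
under eq_bigr do rewrite mcoeffZ mcoeffX.
have [mN|mN] := eqVneq (mdeg m) N; last first.
  rewrite fN// big1// => n _; case: eqVneq => [e|]; rewrite ?mulr0//.
  by move: mN; rewrite -e mdeg_homog_exp ?eqxx// -ltnS bmdeg.
have mS : (mdeg (dehomog_exp m) < N.+1)%N.
  by rewrite ltnS -mN -(mdeg_dehomog_exp m) leq_addl.
have mE : homog_exp N (dehomog_exp m) = m by rewrite -mN dehomog_expK.
rewrite (bigD1 (BMultinom mS))//= mE eqxx mulr1 big1 ?addr0//.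
move=> n nm; case: eqVneq => [e|]; rewrite ?mulr0//.
by case/eqP: nm; apply/val_inj; rewrite /= -e homog_expK.
Qed.

End Homogenization.

(** As [b] inverts [a], substituting [linform b l] for [w_l] sends [linform a j] to the variable
    [z_j] and the whole product to [z^x]. The sum is the coefficient of [z^y] after this
    substitution in the homogeneous expansion. *)
Lemma prodform_inverse {R : comNzRingType} {r N : nat}
    (a b : 'I_r.+1 -> 'I_r.+1 -> R) (x y : multinom r.+1) :
  (forall j k, \sum_(l < r.+1) a j l * b l k = (j == k)%:R) -> mdeg x = N ->
  \sum_(n : bmultinom r N.+1) mcoeff (homog_exp N n) (prodform a x) *
    mcoeff y (prodform b (homog_exp N n)) = (x == y)%:R.
Proof.
move=> ab xN; pose B := [tuple linform b l | l < r.+1].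
have compX m : comp_mpoly B (mpolyX R m) = prodform b m.
  rewrite comp_mpolyX /prodform; by apply: eq_bigr => l _; rewrite tnth_mktuple.
have comp_lin j : comp_mpoly B (linform a j) = mpolyX R (mnm1 j).
  rewrite raddf_sum/=.
  transitivity (\sum_l a j l *: linform b l).
    by apply: eq_bigr => l _; rewrite linearZ/= comp_mpolyXU -tnth_nth tnth_mktuple.
  under eq_bigr do rewrite scaler_sumr.
  rewrite exchange_big/= (bigD1 j)//= [X in _ + X]big1 ?addr0 => [|k kj].
    by under eq_bigr do rewrite scalerA; rewrite -scaler_suml ab eqxx scale1r.
  under eq_bigr do rewrite scalerA.
  by rewrite -scaler_suml ab eq_sym (negPf kj) scale0r.
have comp_form : comp_mpoly B (prodform a x) = mpolyX R x.
  rewrite rmorph_prod; under eq_bigr do rewrite rmorphXn/= comp_lin.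
  by rewrite [RHS]mpolyXE_id.
rewrite -mcoeffX -comp_form.
rewrite [in RHS](homogeneous_expansion (N := N) (f := prodform a x)); last first.
  by move=> m; rewrite -xN; apply: prodform_homog.
rewrite [comp_mpoly _ _]raddf_sum raddf_sum /=; apply: eq_bigr => n _.
by rewrite linearZ/= mcoeffZ compX.
Qed.

Lemma krawtchoukE (R : realType) (r N : nat) (u : 'I_r.+1 -> 'I_r.+1 -> R)
    (n : multinom r) (x : multinom r.+1) :
  (forall j, u ord0 j = 1) -> mdeg x = N -> (mdeg n <= N)%N ->
  krawtchouk u n x = mcoeff (homog_exp N n) (prodform (fun j l => u l j) x).
Proof.
move=> u0 xN nN.
(* Setting [w_0 = 1] recovers the generating function, as [u ord0] is constantly 1. By homogeneity
   no two monomials merge. *)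
pose B := [tuple (if unlift ord0 i is Some k then mpolyX R (mnm1 k) else 1) | i < r.+1].
have BX m : comp_mpoly B (mpolyX R m) = mpolyX R (dehomog_exp m).
  rewrite comp_mpolyX big_ord_recl tnth_mktuple unlift_none expr1n mul1r.
  rewrite mpolyXE_id; apply: eq_bigr => i _.
  by rewrite tnth_mktuple liftK mnmE.
have -> : krawtchouk u n x =
    mcoeff n (comp_mpoly B (prodform (fun j l => u l j) x)).
  congr (mcoeff n _); rewrite rmorph_prod; apply: eq_bigr => j _.
  rewrite rmorphXn/=; congr (_ ^+ _); rewrite raddf_sum/= big_ord_recl.
  rewrite u0 scale1r comp_mpolyXU -tnth_nth tnth_mktuple unlift_none.
  congr (_ + _); apply: eq_bigr => i _.
  by rewrite linearZ/= comp_mpolyXU -tnth_nth tnth_mktuple liftK.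
rewrite [in LHS](homogeneous_expansion (N := N) (f := prodform _ x)); last first.
  by move=> m; rewrite -xN; apply: prodform_homog.
rewrite [comp_mpoly _ _]raddf_sum raddf_sum/= (bigD1 (BMultinom (n := r) (bound := N.+1) (bmnm := n) nN))//=.
rewrite linearZ/= mcoeffZ BX homog_expK mcoeffX eqxx mulr1 big1 ?addr0//.
move=> k kn; rewrite linearZ/= mcoeffZ BX homog_expK mcoeffX.
case: eqVneq => [e|]; rewrite ?mulr0//.
by case/eqP: kn; apply/val_inj; rewrite /= e.
Qed.

(** * Conditional probabilities, and exponentials obtained from local increments *)

Section JumpProcess.
Context {R : realType} {disp : measure_display} {T : measurableType disp}.
Context {Pr : probability T R}.

Lemma sum_fine_fiber (S : finType) (Y : T -> S) (B : set T) :
  (forall y, measurable [set w | Y w = y]) -> measurable B ->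
  \sum_y fine (Pr ([set w | Y w = y] `&` B)) = fine (Pr B).
Proof.
move=> mY mB.
have BE : B = \bigcup_(y in [set` index_enum S]) ([set w | Y w = y] `&` B).
  apply/seteqP; split => [w Bw|w [y _ []]//].
  by exists (Y w) => //=; rewrite mem_index_enum.
rewrite [in RHS]BE measure_fin_bigcup//.
- rewrite -fsbig_seq ?index_enum_uniq// sum_fine// => y _.
  by apply: fin_num_measure; apply: measurableI.
- by apply/trivIsetP => y1 y2 _ _ /eqP ne; apply/seteqP; split => // w [[/= -> _] [/= /ne]].
- by move=> y _; apply: measurableI.
Qed.

Lemma sum_cond_prob_fiber (S : finType) (Y : T -> S) (B : set T) :
  (forall y, measurable [set w | Y w = y]) -> measurable B -> Pr B != 0%E ->
  \sum_y cond_prob Pr [set w | Y w = y] B = 1.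
Proof.
move=> mY mB B0; rewrite /cond_prob -mulr_suml sum_fine_fiber// divff//.
by rewrite fine_eq0// fin_num_measure.
Qed.

Lemma cond_prob_ge0 (A B : set T) : 0 <= cond_prob Pr A B.
Proof. by rewrite /cond_prob divr_ge0// fine_ge0. Qed.

End JumpProcess.

Lemma exponential_of_increment {R : realType} (F : R -> R) (c : R) :
  (forall e : R, 0 < e -> exists2 del : R, 0 < del & forall h s : R, 0 < h < del -> 0 <= s ->
    `|F (s + h) - expR (- c * h) * F s| <= e * h) ->
  forall t : R, 0 <= t -> F t = expR (- c * t) * F 0.
Proof.
move=> Fc t; rewrite le_eqVlt => /predU1P[<-|t0].
  by rewrite mulr0 expR0 mul1r.
(* [K] is the bound on the integrating factor times the total length of the steps. *)
have [K K0 KE] : exists2 K : R, 0 < K & K = expR (`|c| * t) * t.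
  by exists (expR (`|c| * t) * t); rewrite ?mulr_gt0// expR_gt0.
suff H e : 0 < e -> `|expR (c * t) * F t - F 0| <= e * K.
  apply: (mulfI (negbT (expR_eq0 (c * t)))).
  rewrite mulrA -expRD mulNr subrr expR0 mul1r.
  apply/eqP; rewrite -subr_eq0 -normr_le0 leNgt; apply/negP => A0.
  have K20 : 0 < 2 * K by rewrite mulr_gt0.
  (* With [e] the error divided by [2 * K], a positive error would be at most half of itself. *)
  have := H _ (divr_gt0 A0 K20).
  by rewrite invfM mulrA divfK ?gt_eqF//; move: A0; lra.
move=> e0; have [del del0 Hdel] := Fc e e0.
have [n n0 tn] : exists2 n : nat, (0 < n)%N & t / n%:R < del.
  exists (Num.bound (t / del)).+1 => //.
  rewrite ltr_pdivrMr ?ltr0n// -ltr_pdivrMl// mulrC.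
  have : t / del < (Num.bound (t / del))%:R by rewrite archi_boundP// divr_ge0// ltW.
  by move=> /lt_le_trans; apply; rewrite ler_nat.
pose h := t / n%:R.
have h0 : 0 < h by rewrite divr_gt0// ltr0n.
have nh : n%:R * h = t by rewrite mulrC divfK// pnatr_eq0 -lt0n.
have step k : (k <= n)%N ->
    `|expR (c * (k%:R * h)) * F (k%:R * h) - F 0|
      <= k%:R * (expR (`|c| * t) * (e * h)).
  elim: k => [_|k IH kn]; first by rewrite !mul0r mulr0 expR0 mul1r subrr normr0.
  rewrite -natr1 [(_ + 1) * (expR _ * _)]mulrDl mul1r.
  rewrite [(_ + 1) * h]mulrDl mul1r.
  (* Telescoping: the error after [k] steps plus the weighted error of one more. *)
  have -> : expR (c * (k%:R * h + h)) * F (k%:R * h + h) - F 0 =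
    (expR (c * (k%:R * h)) * F (k%:R * h) - F 0) +
    expR (c * (k%:R * h + h)) *
      (F (k%:R * h + h) - expR (- c * h) * F (k%:R * h)).
    have -> : expR (c * (k%:R * h)) = expR (c * (k%:R * h + h)) * expR (- c * h).
      by rewrite -expRD; congr expR; ring.
    by ring.
  rewrite (le_trans (ler_normD _ _))// lerD ?IH ?(ltnW kn)//.
  rewrite normrM gtr0_norm ?expR_gt0// ler_pM ?expR_ge0//; last first.
    by apply: Hdel; [rewrite h0|rewrite mulr_ge0// ltW].
  rewrite ler_expR.
  have kt : k%:R * h + h <= t.
    by rewrite -nh -[X in _ + X]mul1r -mulrDl natr1 ler_wpM2r ?ler_nat// ltW.
  rewrite (le_trans (ler_norm _))// normrM ler_wpM2l// ger0_norm//.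
  by rewrite addr_ge0 ?mulr_ge0// ltW.
have := step n (leqnn n); rewrite nh => /le_trans; apply.
by rewrite le_eqVlt; apply/orP; left; apply/eqP; rewrite KE -nh; ring.
Qed.

Lemma expR_increment_at_right {R : realType} (c : R) :
  ((expR (- c * h) - 1) / h) @[h --> 0^'+] --> - c.
Proof.
apply: cvg_dnbhs_at_right.
have H : is_derive (0 : R) (1 : R) (expR \o (- c \*: id)) (expR (- c *: 0) * (- c *: 1)).
  exact: is_derive1_comp.
have [dH] := H; rewrite /derive scaler0 expR0 mul1r [RHS]mulr1 => eH.
move: dH; rewrite /derivable eH => dH.
apply: cvg_trans dH; apply: near_eq_cvg; apply: nearW => h /=.
rewrite addr0 scaler0 expR0 [RHS]mulrC; congr (_ * (expR _ - _)).
by rewrite /GRing.scale/= mulr1.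
Qed.

(** * Expectations of eigenfunctions along a jump process *)

Section JumpProcessEigenfunction.
Context {R : realType} {disp : measure_display} {T : measurableType disp}.
Context {Pr : probability T R} {S : finType} {X : R -> T -> S} {q : S -> S -> R}.
Context (HX : is_jump_process Pr X q) (phi : S -> R) (c : R)
  (eigen : forall x, \sum_y q x y * (phi y - phi x) = - c * phi x).

Let trans s h x y :=
  cond_prob Pr [set w | X (s + h) w = y] [set w | X s w = x].

(** Only transitions to [y != x] have prescribed rates. The probability of staying is eliminated by
    total mass 1, which produces the differences [phi y - phi x] of the generator. *)
Lemma eigenfunction_increment_at_right (s : R) x :
  0 <= s -> Pr [set w | X s w = x] != 0%E ->
  ((\sum_y trans s h x y * phi y - expR (- c * h) * phi x) / h)
    @[h --> 0^'+] --> (0 : R).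
Proof.
move=> s0 sx.
have limE : \sum_(y | x != y) q x y * (phi y - phi x) - - c * phi x = 0.
  apply/eqP; rewrite subr_eq0 -eigen [eqbRHS](bigD1 x)//= subrr mulr0 add0r.
  by apply/eqP/eq_bigl => y; rewrite eq_sym.
have H : (\sum_(y | x != y) (trans s h x y / h) * (phi y - phi x)
     - (expR (- c * h) - 1) / h * phi x) @[h --> 0^'+] -->
    \sum_(y | x != y) q x y * (phi y - phi x) - - c * phi x.
  apply: cvgB.
    apply: (@cvg_big _ _ _ _ _ (@add_continuous R) _ _ _
      (fun y h => trans s h x y / h * (phi y - phi x))) => y xy.
    apply: (cvgMr_tmp (f := fun h => trans s h x y / h)).
    exact: (jp_rate HX s0 xy sx).
  apply: (cvgMr_tmp (f := fun h => (expR (- c * h) - 1) / h)).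
  exact: expR_increment_at_right.
rewrite limE in H.
apply: cvg_trans H; apply: near_eq_cvg.
near=> h.
have h0 : 0 < h by near: h; exact: nbhs_right_gt.
(* The probability of staying at [x] is one minus the others. *)
have : \sum_y trans s h x y = 1.
  apply: sum_cond_prob_fiber => //; last exact: (jp_measurable HX).
  by move=> y; apply: (jp_measurable HX); rewrite addr_ge0// ltW.
rewrite (bigD1 x)//= => /eqP; rewrite eq_sym -subr_eq => /eqP e1.
rewrite [in RHS](bigD1 x)//= -e1.
transitivity ((\sum_(y | y != x) trans s h x y * (phi y - phi x)
     - (expR (- c * h) - 1) * phi x) / h).
  rewrite [RHS]mulrBl mulr_suml [in RHS]mulrAC; congr (_ - _).
  under [LHS]eq_bigl do rewrite eq_sym.
  by apply: eq_bigr => y _; rewrite mulrAC.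
congr (_ / h).
have -> : \sum_(y | y != x) trans s h x y * (phi y - phi x) =
    \sum_(y | y != x) trans s h x y * phi y -
    (\sum_(y | y != x) trans s h x y) * phi x.
  by rewrite mulr_suml -sumrB; apply: eq_bigr => y _; rewrite mulrBr.
by ring.
Unshelve. all: by end_near. Qed.

(** Uniformity in [s] comes from time homogeneity, uniformity in [x] from finiteness of [S]. *)
Lemma eigenfunction_increment_uniform (e : R) : 0 < e ->
  exists2 del : R, 0 < del & forall (h s : R) x, 0 < h < del -> 0 <= s ->
    Pr [set w | X s w = x] != 0%E ->
    `|\sum_y trans s h x y * phi y - expR (- c * h) * phi x| <= e * h.
Proof.
move=> e0.
have : \forall h \near (0 : R)^'+, forall x (s : R), 0 <= s ->
    Pr [set w | X s w = x] != 0%E ->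
    `|\sum_y trans s h x y * phi y - expR (- c * h) * phi x| <= e * h.
  apply: filter_forall => x.
  (* Either [x] has positive probability at some reference time [s0], to which all other times are
     compared, or the claim for [x] is vacuous. *)
  have [[s0 [s0_ge0 s0x]]|nos] := pselect (exists s : R,
      0 <= s /\ Pr [set w | X s w = x] != 0%E); last first.
    by apply: nearW => h s sge sx; case: nos; exists s.
  have /cvgr0_norm_le/(_ e e0) := eigenfunction_increment_at_right s0_ge0 s0x.
  apply: filterS2 (nbhs_right_gt 0) => h h0 He s s_ge0 sx.
  have tE y : trans s h x y = trans s0 h x y.
    by apply: (jp_homogeneous HX) => //; apply: ltW.
  under eq_bigr do rewrite tE.
  by move: He; rewrite normrM [ `|h^-1|]gtr0_norm ?invr_gt0// ler_pdivrMr.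
move=> [del /= del0 H]; exists del => // h s x /andP[h0 hdel]; apply: H => //=.
by rewrite sub0r normrN gtr0_norm.
Qed.

(** Chapman-Kolmogorov: split over the state at time [s], then forget the initial state by the
    Markov property. *)
Lemma cond_prob_step (s h : R) x y :
  0 <= s -> 0 <= h -> Pr [set w | X 0 w = x] != 0%E ->
  cond_prob Pr [set w | X (s + h) w = y] [set w | X 0 w = x] =
  \sum_z cond_prob Pr [set w | X s w = z] [set w | X 0 w = x] * trans s h z y.
Proof.
move=> s0 h0 x0.
have mX (t : R) u : 0 <= t -> measurable [set w | X t w = u].
  exact: (jp_measurable HX).
have msh : measurable [set w | X (s + h) w = y] by apply: mX; rewrite addr_ge0.
rewrite {1}/cond_prob.
rewrite -(@sum_fine_fiber _ _ _ Pr S (X s)); last 2 first.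
- by move=> u; apply: mX.
- by apply: measurableI => //; apply: mX.
rewrite mulr_suml; apply: eq_bigr => u _.
rewrite {1}/cond_prob mulrAC; congr (_ / _).
have mB : measurable ([set w | X s w = u] `&` [set w | X 0 w = x]).
  by apply: measurableI; apply: mX.
have -> : [set w | X s w = u] `&` ([set w | X (s + h) w = y] `&` [set w | X 0 w = x])
    = [set w | X (s + h) w = y] `&` ([set w | X s w = u] `&` [set w | X 0 w = x]).
  by rewrite setICA.
(* The Markov property only speaks of histories of positive probability; for a null one both sides
   vanish. *)
have [B0|B0] := eqVneq (Pr ([set w | X s w = u] `&` [set w | X 0 w = x])) 0%E.
  rewrite B0 mul0r; suff -> : Pr ([set w | X (s + h) w = y] `&`
     ([set w | X s w = u] `&` [set w | X 0 w = x])) = 0%E by [].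
  apply/eqP; rewrite eq_le measure_ge0 andbT -B0.
  by rewrite le_measure ?inE//; exact: measurableI.
(* The history is the single observation of [x] at time 0. *)
have := @jp_markov _ _ _ _ _ _ _ HX 1 (fun=> 0) (fun=> x) s h u y s0 h0.
rewrite /= lexx s0 => /(_ (fun=> isT)).
have -> : [set w | 'I_1 -> X 0 w = x] = [set w | X 0 w = x].
  by apply/seteqP; split => w //= /(_ ord0).
rewrite B0 => /(_ isT); rewrite -/(trans s h u y) => <-.
by rewrite /cond_prob mulrC divfK// fine_eq0// fin_num_measure.
Qed.

Lemma expectation_eigenfunction x (t : R) :
  0 <= t -> Pr [set w | X 0 w = x] != 0%E ->
  \sum_y cond_prob Pr [set w | X t w = y] [set w | X 0 w = x] * phi y =
  expR (- c * t) * phi x.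
Proof.
move=> t0 x0.
have mX (s : R) u : 0 <= s -> measurable [set w | X s w = u].
  exact: (jp_measurable HX).
pose F (s : R) :=
  \sum_y cond_prob Pr [set w | X s w = y] [set w | X 0 w = x] * phi y.
have F0 : F 0 = phi x.
  rewrite /F (bigD1 x)//= big1 ?addr0 => [|y yx].
    by rewrite /cond_prob setIid divff ?mul1r// fine_eq0 ?fin_num_measure//; apply: mX.
  rewrite /cond_prob (_ : _ `&` _ = set0) ?measure0 ?mul0r//.
  by apply/seteqP; split => // w [/= -> /eqP]; rewrite (negPf yx).
rewrite -/(F t) -F0; apply: exponential_of_increment => // e e0.
have [del del0 Hdel] := eigenfunction_increment_uniform e0.
exists del => // h s hdel s0.
have h0 : 0 <= h by case/andP: hdel => /ltW.
(* The error is an average of one-step errors over the state at time [s], with weights summing to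
   1. *)
have -> : F (s + h) - expR (- c * h) * F s =
    \sum_z cond_prob Pr [set w | X s w = z] [set w | X 0 w = x] *
      (\sum_y trans s h z y * phi y - expR (- c * h) * phi z).
  under [RHS]eq_bigr do rewrite mulrBr.
  rewrite sumrB; congr (_ - _); last first.
    by rewrite mulr_sumr; apply: eq_bigr => z _; rewrite mulrCA.
  under [RHS]eq_bigr do rewrite mulr_sumr.
  rewrite exchange_big; apply: eq_bigr => y _ /=.
  rewrite cond_prob_step// mulr_suml.
  by apply: eq_bigr => z _; rewrite [RHS]mulrA.
rewrite (le_trans (ler_norm_sum _ _ _))//.
rewrite -[leRHS]mul1r -(@sum_cond_prob_fiber _ _ _ Pr S (X s) _ _ _ x0)//; last 2 first.
- by move=> y; apply: mX.
- exact: mX.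
rewrite mulr_suml; apply: ler_sum => z _.
rewrite normrM ger0_norm ?cond_prob_ge0//.
(* The uniform bound needs a state of positive probability; otherwise the weight of [z] is 0. *)
have [z0|z0] := eqVneq (Pr [set w | X s w = z]) 0%E; last first.
  by apply: ler_wpM2l; [exact: cond_prob_ge0|exact: Hdel].
suff -> : cond_prob Pr [set w | X s w = z] [set w | X 0 w = x] = 0 by rewrite !mul0r.
rewrite /cond_prob (_ : Pr (_ `&` _) = 0%E) ?mul0r//.
apply/eqP; rewrite eq_le measure_ge0 andbT -z0 le_measure ?inE//.
- by apply: measurableI; apply: mX.
- exact: mX.
Qed.

End JumpProcessEigenfunction.

(** * Configurations and the generator of the walk *)

Lemma mdeg_config d N (x : config d N) : mdeg x = N.
Proof. exact/eqP/(valP x). Qed.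

Lemma config_vec_inj d N : injective (@config_vec d N).
Proof. by move=> x y xy; do 2!apply: val_inj. Qed.

Lemma config_ex d N (m : multinom d) : mdeg m = N -> exists x : config d N, x = m :> multinom d.
Proof.
move=> mN; have mlt : (mdeg m < N.+1)%N by rewrite mN.
have mE : mdeg (BMultinom mlt) == N by rewrite /= mN.
by exists (exist _ (BMultinom mlt) mE).
Qed.

(** The function [g] lives on all exponents: if [x j = 0], truncation makes its argument one of
    degree [N.+1], no configuration, but the coefficient is then 0. *)
Lemma walk_rate_sum {R : realType} {d N : nat} (P : 'I_d -> 'I_d -> R)
    (x : config d N) (g : multinom d -> R) :
  \sum_(y : config d N) walk_rate P x y * g y =
  \sum_(j < d) \sum_(l < d) (x j)%:R / N%:R * P j l *
    g (mnm_add (mnm_sub x (mnm1 j)) (mnm1 l)).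
Proof.
under eq_bigr do rewrite /walk_rate mulr_suml.
rewrite exchange_big /=; apply: eq_bigr => j _.
under eq_bigr do rewrite big_mkcond/= mulr_suml.
rewrite exchange_big /=; apply: eq_bigr => l _.
have [xj|xj] := posnP (x j).
  rewrite xj !mul0r big1// => y _.
  by case: ifP; rewrite ?mul0r.
have addK : mnm_add (mnm_add (mnm_sub x (mnm1 j)) (mnm1 l)) (mnm1 j) =
    mnm_add x (mnm1 l).
  by rewrite -addmA [mnm_add (mnm1 l) _]addmC addmA submU1K.
have [z zE] : exists z : config d N,
    z = mnm_add (mnm_sub x (mnm1 j)) (mnm1 l) :> multinom d.
  apply: config_ex; apply/eqP.
  rewrite -(eqn_add2r (mdeg (mnm1 j))) -mdegD addK.
  by rewrite mdegD !mdeg1 mdeg_config.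
rewrite (bigD1 z)//= zE addK eqxx big1 ?addr0// => y yz.
case: eqVneq => [e|]; rewrite ?mul0r//; case/eqP: yz; apply: config_vec_inj.
by rewrite zE; apply: (can_inj (addmK (mnm1 j))); rewrite addK.
Qed.

Lemma walk_rate_eigenfunction {R : realType} {r N : nat} (hN : (0 < N)%N)
    (a P : 'I_r.+1 -> 'I_r.+1 -> R) (rho : 'I_r -> R) (n : multinom r)
    (x : config r.+1 N) :
  (forall j, \sum_l P j l = 1) ->
  (forall j, \sum_l P j l * a l ord0 = a j ord0) ->
  (forall j i, \sum_l P j l * a l (lift ord0 i) = rho i * a j (lift ord0 i)) ->
  (mdeg n <= N)%N ->
  let phi (y : config r.+1 N) := mcoeff (homog_exp N n) (prodform a y) in
  \sum_y walk_rate P x y * (phi y - phi x) =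
  - (\sum_i (n i)%:R * (1 - rho i) / N%:R) * phi x.
Proof.
move=> P1 Pa0 PaS nN phi.
have N0 : N%:R != 0 :> R by rewrite pnatr_eq0 -lt0n.
rewrite (walk_rate_sum P x
  (fun y => mcoeff (homog_exp N n) (prodform a y) - phi x)).
(* The constant function has eigenvalue 1, so the part [n_0 = N - mdeg n] contributes itself. *)
pose lam (i : 'I_r.+1) := if unlift ord0 i is Some k then rho k else 1.
have Plam j i : \sum_l P j l * a l i = lam i * a j i.
  rewrite /lam; case: (unliftP ord0 i) => [k|] ->; last by rewrite mul1r Pa0.
  by rewrite PaS.
have := prodform_generator x (homog_exp N n) Plam.
have -> : \sum_i lam i * (homog_exp N n i)%:R =
    N%:R - (mdeg n)%:R + \sum_i rho i * (n i)%:R.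
  rewrite big_ord_recl homog_exp0 {1}/lam unlift_none mul1r natrB//.
  by congr (_ + _); apply: eq_bigr => i _; rewrite homog_expS /lam liftK.
rewrite -/(phi x).
set G := \sum_(j < r.+1) _ => GE.
transitivity (N%:R^-1 * (G - N%:R * phi x)).
  (* The total rate, jumps from [x] to itself included, is 1; this yields the subtracted [phi x]. *)
  have xN : N%:R = \sum_j \sum_l (x j)%:R * P j l.
    under eq_bigr do rewrite -mulr_sumr P1 mulr1.
    by rewrite -natr_sum -mdegE mdeg_config.
  rewrite [X in _ - X * _]xN mulr_suml -sumrB mulr_sumr; apply: eq_bigr => j _.
  rewrite mulr_suml -sumrB mulr_sumr; apply: eq_bigr => l _.
  by ring.
rewrite GE -mulr_suml mdegE natr_sum.
under [X in - (X / _) * _]eq_bigr do rewrite mulrBr mulr1.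
rewrite sumrB.
under [X in - ((_ - X) / _) * _]eq_bigr do rewrite mulrC.
by field.
Qed.

(** * Dual orthogonality and the spectral expansion *)

Lemma orthonormal_dual {R : comNzRingType} {d : nat} (u : 'I_d -> 'I_d -> R)
    (p : 'I_d -> R) :
  (forall l m, \sum_i u l i * u m i * p i = (l == m)%:R) ->
  forall j k, \sum_l u l j * (p k * u l k) = (j == k)%:R.
Proof.
move=> u_orth j k.
pose A := \matrix_(l, i) u l i; pose B := \matrix_(i, l) (p i * u l i).
(* For square matrices a one-sided inverse is two-sided, so orthonormality in [i] gives
   orthogonality in [l]. *)
have /mulmx1C/matrixP/(_ k j) : A *m B = 1%:M.
  apply/matrixP => l m; rewrite !mxE -u_orth; apply: eq_bigr => i _.
  by rewrite !mxE; ring.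
rewrite !mxE eq_sym => <-; apply: eq_bigr => l _.
by rewrite !mxE; ring.
Qed.

Lemma prodform_scale {R : comNzRingType} {d : nat} (p : 'I_d -> R)
    (a : 'I_d -> 'I_d -> R) (x : multinom d) :
  prodform (fun j l => p j * a j l) x = \prod_j p j ^+ x j *: prodform a x.
Proof.
rewrite -scaler_prod; apply: eq_bigr => j _; rewrite -exprZn; congr (_ ^+ _).
by rewrite scaler_sumr; apply: eq_bigr => l _; rewrite scalerA.
Qed.

Theorem theorem8 (R : realType) (N r : nat) (hN : (1 <= N)%N) (hr : (1 <= r)%N)
    (p : 'I_r.+1 -> R)
    (p_gt0 : forall j, 0 < p j) (p_sum : \sum_(j < r.+1) p j = 1)
    (u : 'I_r.+1 -> 'I_r.+1 -> R)
    (u0 : forall j, u ord0 j = 1)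
    (u_orth : forall l m : 'I_r.+1,
      \sum_(i < r.+1) u l i * u m i * p i = (l == m)%:R)
    (P : 'I_r.+1 -> 'I_r.+1 -> R)
    (P_ge0 : forall j l, 0 <= P j l)
    (P_row : forall j, \sum_(l < r.+1) P j l = 1)
    (P_stat : forall l, \sum_(j < r.+1) p j * P j l = p l)
    (rho : 'I_r -> R)
    (P_spec : forall j l, P j l =
      p l * (1 + \sum_(i < r) rho i * u (lift ord0 i) j * u (lift ord0 i) l))
    (disp : measure_display) (T : measurableType disp) (Pr : probability T R)
    (X : R -> T -> config r.+1 N)
    (X_walk : is_jump_process Pr X (walk_rate P))
    (x y : config r.+1 N) (t : R) (ht : 0 <= t)
    (hx : Pr [set w | X 0 w = x] != 0%E) :
  cond_prob Pr [set w | X t w = y] [set w | X 0 w = x]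
  = multinomial_pmf p y *
    (1 + \sum_(n : mpoly.bmultinom r N.+1 | (0 < mpoly.mdeg n)%N)
      expR (- t * (\sum_(i < r) (n i)%:R * (1 - rho i) / N%:R))
      * (multinomial_coef N n)^-1 * krawtchouk u n x * krawtchouk u n y).
Proof.
pose a j l := u l j; pose b l k := p k * u l k.
pose K (n : multinom r) (z : config r.+1 N) :=
  mcoeff (homog_exp N n) (prodform a z).
pose c (n : multinom r) := \sum_(i < r) (n i)%:R * (1 - rho i) / N%:R.
have le_bm (n : bmultinom r N.+1) : (mdeg n <= N)%N by rewrite -ltnS bmdeg.
have KE (n : bmultinom r N.+1) (z : config r.+1 N) : krawtchouk u n z = K n z.
  by apply: krawtchoukE; rewrite ?mdeg_config.
(* Duality exchanges [y] and [homog_exp N n]. The powers of [p] and the factorials left over form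
   the multinomial probability and the inverse coefficient. *)
have DE (n : bmultinom r N.+1) : mcoeff y (prodform b (homog_exp N n)) =
    multinomial_pmf p y * (multinomial_coef N n)^-1 * K n y.
  have := prodform_duality (fun j l => p j * a j l) y (homog_exp N n).
  rewrite prodform_scale mcoeffZ -/(K n y) -/b.
  have -> : mfact (homog_exp N n) = ((N - mdeg n)`! * \prod_(i < r) (n i)`!)%N.
    rewrite /mfact big_ord_recl homog_exp0; congr (_ * _)%N.
    by apply: eq_bigr => i _; rewrite homog_expS.
  rewrite /mfact /multinomial_pmf /multinomial_coef -!natr_prod natrM => e.
  have fact_neq0 k (m : multinom k) : (\prod_i (m i)`!)%N%:R != 0 :> R.
    by rewrite pnatr_eq0 -lt0n prodn_gt0// => i; rewrite fact_gt0.
  apply: (mulIf (fact_neq0 _ y)); rewrite -e.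
  by field; rewrite !fact_neq0 !pnatr_eq0 -!lt0n !fact_gt0.
(* Orthonormality applied to the spectral form of [P]; the 1 in it is the term of [u ord0]. *)
have P_orth j i : \sum_l P j l * u i l = (ord0 == i)%:R +
    \sum_(k < r) rho k * u (lift ord0 k) j * (lift ord0 k == i)%:R.
  under eq_bigr do rewrite P_spec mulrDr mulr1 mulrDl.
  rewrite big_split /= -u_orth; congr (_ + _).
    by apply: eq_bigr => l _; rewrite u0 mul1r mulrC.
  under [RHS]eq_bigr do rewrite -u_orth mulr_sumr.
  rewrite exchange_big; apply: eq_bigr => l _ /=.
  by rewrite mulr_sumr mulr_suml; apply: eq_bigr => k _; ring.
have Pa0 j : \sum_l P j l * a l ord0 = a j ord0.
  by rewrite P_orth eqxx big1 ?addr0 ?/a ?u0// => k _; rewrite mulr0.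
have PaS j i : \sum_l P j l * a l (lift ord0 i) = rho i * a j (lift ord0 i).
  rewrite P_orth add0r (bigD1 i)//= eqxx mulr1 big1 ?addr0// => k ki.
  by rewrite (inj_eq lift_inj) (negPf ki) mulr0.
have EK (n : bmultinom r N.+1) :
    \sum_z cond_prob Pr [set w | X t w = z] [set w | X 0 w = x] * K n z =
    expR (- t * c n) * K n x.
  rewrite (expectation_eigenfunction X_walk (phi := K n) (c := c n))//.
    by congr (expR _ * _); ring.
  by move=> z; apply: walk_rate_eigenfunction.
(* The transition probability is the expectation of the indicator of [y], next expanded in the
   eigenfunctions [K n]. *)
have -> : cond_prob Pr [set w | X t w = y] [set w | X 0 w = x] =
    \sum_z cond_prob Pr [set w | X t w = z] [set w | X 0 w = x] *
      (config_vec z == config_vec y)%:R.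
  rewrite (bigD1 y)//= eqxx mulr1 big1 ?addr0// => z zy.
  by rewrite (inj_eq (@config_vec_inj _ _)) (negPf zy) mulr0.
have ab := orthonormal_dual u_orth.
under eq_bigr => z _.
  rewrite -(prodform_inverse y ab (mdeg_config z)) mulr_sumr; over.
rewrite exchange_big /=.
(* The isolated 1 is the term [n = 0]: eigenvalue, coefficient and polynomial are 0, 1 and 1. *)
have -> : 1 + \sum_(n : bmultinom r N.+1 | (0 < mdeg n)%N)
      expR (- t * c n) * (multinomial_coef N n)^-1 * krawtchouk u n x
        * krawtchouk u n y =
    \sum_(n : bmultinom r N.+1) expR (- t * c n) * (multinomial_coef N n)^-1 *
      krawtchouk u n x * krawtchouk u n y.
  rewrite [RHS](bigD1 bm0)//=; congr (_ + _); last first.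
    by apply: eq_bigl => n; rewrite lt0n mdeg_eq0.
  have krawtchouk0 (z : multinom r.+1) : krawtchouk u mnm0 z = 1.
    rewrite /krawtchouk rmorph_prod big1// => j _.
    rewrite rmorphXn/= mcoeffD mcoeff1 eqxx raddf_sum big1 ?addr0 ?expr1n// => i _.
    by rewrite /= mcoeffZ mcoeffX mnm1_eq0 mulr0.
  rewrite !krawtchouk0 !mulr1 /c big1 => [|i _]; last by rewrite mnm0E !mul0r.
  rewrite mulr0 expR0 mul1r /multinomial_coef mdeg0 subn0 big1 => [|i _].
    by rewrite mulr1 divff ?invr1// pnatr_eq0 -lt0n fact_gt0.
  by rewrite mnm0E.
rewrite mulr_sumr; apply: eq_bigr => n _.
rewrite !KE.
transitivity (expR (- t * c n) * K n x * mcoeff y (prodform b (homog_exp N n))).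
  by rewrite -EK mulr_suml; apply: eq_bigr => z _; rewrite mulrA.
by rewrite DE; ring.
Qed.
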